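(* Let $f:\mathbb{R}^d\to\mathbb{R}$ be continuously differentiable, convex, and bounded below, with $\nabla f$ $L$-Lipschitz continuous for a constant $L>0$. Run the BFGS method with Armijo-Wolfe line search (as described in the context) on $f$ from an arbitrary $x_0\in\mathbb{R}^d$, with a symmetric positive definite $B_0$ and parameters $0<c_1<c_2<1$. Let $f^\star:=\inf_{x\in\mathbb{R}^d} f(x)$, $\Delta_k:=f(x_k)-f^\star$, $g_k:=\nabla f(x_k)$, $\gamma:=c_1(1-c_2)$ and $\Psi_0:=\Psi_L(B_0)$. Let $k\ge 1$ be an integer. If some iterate $x_j$, $0\le j\le k$, is optimal (a minimizer of $f$), then the method terminates. Otherwise, the following hold. (1) $$\min_{0\le i<k}\|g_i\|^2\le \frac{L\Delta_0}{\gamma k}\exp\!\left(\frac{\Psi_0}{k}\right).$$ (2) Let $X^\star:=\operatorname{argmin}_{x\in\mathbb{R}^d} f(x)$. If $X^\star\neq\varnothing$ and $$W_0:=\sup_{x\notin X^\star:\ f(x)\le f(x_0)}\frac{f(x)-f^\star}{\|\nabla f(x)\|}<\infty,$$ then $$\Delta_k\le\left[\frac{1}{\Delta_0}+\frac{\gamma k}{L W_0^2}\,e^{-\Psi_0/k}\right]^{-1}.$$ (3) If, in addition to the hypotheses of (2), $B_0=LI$, then $$\frac{\|g_k\|^2}{2L}\le \Delta_k\le\frac{L W_0^2}{\gamma k}\le\frac{L R_0^2}{\gamma k},$$ where $R_0:=\sup_{x:\ f(x)\le f(x_0)}\operatorname{dist}(x,X^\star)\in[0,\infty]$ (the last inequality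 being trivial if $R_0=\infty$).
   Context: $\|\cdot\|$ is the Euclidean norm on $\mathbb{R}^d$, $\operatorname{dist}(x,X)=\inf_{z\in X}\|x-z\|$, and $I$ is the $d\times d$ identity matrix. BFGS method with Armijo-Wolfe line search. Input: $x_0\in\mathbb{R}^d$, a symmetric positive definite matrix $B_0\in\mathbb{R}^{d\times d}$, and parameters $0<c_1<c_2<1$. For $k=0,1,2,\dots$: - if $\|\nabla f(x_k)\|=0$, terminate; - set $p_k=-B_k^{-1}\nabla f(x_k)$; - choose any step size $\alpha_k>0$ satisfying both the Armijo condition $f(x_k+\alpha_kp_k)\le f(x_k)+c_1\alpha_k\nabla f(x_k)^\top p_k$ and the Wolfe condition $\nabla f(x_k+\alpha_kp_k)^\top p_k\ge c_2\nabla f(x_k)^\top p_k$; - set $x_{k+1}=x_k+\alpha_kp_k$, $s_k=x_{k+1}-x_k$, $y_k=\nabla f(x_{k+1})-\nabla f(x_k)$, and $$B_{k+1}=B_k-\frac{B_ks_ks_k^\top B_k}{s_k^\top B_ks_k}+\frac{y_ky_k^\top}{y_k^\top s_k}.$$ The step sizes are arbitrary subject to the two line-search conditions; the result concerns every sequence so generated. Potential function: for symmetric positive definite $B\in\mathbb{R}^{d\times d}$, $$\Psi_L(B):=\operatorname{tr}(B/L)-d-\log\det(B/L).$$ *)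

(* Defs.v *)
From HB Require Import structures.
From mathcomp Require Import all_boot all_order all_algebra.
From mathcomp Require Import all_classical all_reals all_analysis.

Set Implicit Arguments.
Unset Strict Implicit.
Unset Printing Implicit Defensive.

Import Order.TTheory GRing.Theory Num.Theory.
Import numFieldNormedType.Exports.

Local Open Scope classical_set_scope.
Local Open Scope ring_scope.

Section Euclidean.
Context {R : realType} {d : nat}.
Implicit Types (u v x : 'cV[R]_d) (f : 'cV[R]_d -> R) (X : set 'cV[R]_d).

Definition dot u v : R := (u^T *m v) 0 0.

(* The library norm `|u| on matrices is the sup norm, hence this definition.
   The two norms induce the same topology, so [differentiable] and
   [continuous] keep their usual meaning. *)
Definition enorm u : R := Num.sqrt (dot u u).

Definition grad f x : 'cV[R]_d := \col_i 'D_(delta_mx i 0) f x.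

(* Extended-real valued, so that the distance to the empty set is +oo. *)
Definition dist x X : \bar R := ereal_inf [set (enorm (x - z))%:E | z in X].

Definition spd (B : 'M[R]_d) : Prop :=
  B^T = B /\ forall v, v != 0 -> 0 < dot v (B *m v).

Definition continuously_differentiable f : Prop :=
  (forall x, differentiable f x) /\ continuous (grad f).

Definition grad_lipschitz f (L : R) : Prop :=
  forall u v, enorm (grad f u - grad f v) <= L * enorm (u - v).

(* Meaningful when [f] is bounded below. *)
Definition fstar f : R := inf (range f).

Definition argmin f : set 'cV[R]_d := [set x | forall z, f x <= f z].

End Euclidean.

Section BFGS.
Context {R : realType} {d : nat}.
Implicit Types (x s y p : 'cV[R]_d) (B : 'M[R]_d) (f : 'cV[R]_d -> R).

Definition bfgs_update B s y : 'M[R]_d :=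
  B - (dot s (B *m s))^-1 *: (B *m s *m s^T *m B)
    + (dot y s)^-1 *: (y *m y^T).

Definition armijo f (c1 : R) x p (a : R) : Prop :=
  f (x + a *: p) <= f x + c1 * a * dot (grad f x) p.

Definition wolfe f (c2 : R) x p (a : R) : Prop :=
  c2 * dot (grad f x) p <= dot (grad f (x + a *: p)) p.

(* A run is a triple of total sequences (x_k), (B_k), (alpha_k). Only the
   entries up to the first k with grad f (x_k) = 0 belong to the method:
   [reached f x k] says that the method has not terminated before producing
   x_k, and nothing is required of the entries after termination. *)
Definition reached f (x : nat -> 'cV[R]_d) (k : nat) : Prop :=
  forall i, (i < k)%N -> enorm (grad f (x i)) != 0.

Definition terminates_at f (x : nat -> 'cV[R]_d) (k : nat) : Prop :=
  reached f x k /\ enorm (grad f (x k)) = 0.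

Definition bfgs_step f (c1 c2 : R) x B (a : R) x' B' : Prop :=
  let p := - (invmx B *m grad f x) in
  [/\ 0 < a, armijo f c1 x p a, wolfe f c2 x p a,
      x' = x + a *: p
    & B' = bfgs_update B (x' - x) (grad f x' - grad f x)].

Definition bfgs_run f (c1 c2 : R) (x0 : 'cV[R]_d) (B0 : 'M[R]_d)
    (x : nat -> 'cV[R]_d) (B : nat -> 'M[R]_d) (alpha : nat -> R) : Prop :=
  [/\ x 0 = x0, B 0 = B0
    & forall k, reached f x k.+1 ->
        bfgs_step f c1 c2 (x k) (B k) (alpha k) (x k.+1) (B k.+1)].

Definition Psi (L : R) B : R :=
  \tr (L^-1 *: B) - d%:R - ln (\det (L^-1 *: B)).

Definition W0 f x0 : \bar R :=
  ereal_sup [set ((f x - fstar f) / enorm (grad f x))%:E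
            | x in [set x | ~ argmin f x /\ f x <= f x0]].

Definition R0 f x0 : \bar R :=
  ereal_sup [set dist x (argmin f) | x in [set x | f x <= f x0]].

End BFGS.

(* Main.v *)
(* Write delta_k = f (x_k) - f (x_(k+1)) and q_k = - <g_k, p_k>. The determinant and
   trace formulas for the BFGS update, cocoercivity of the gradient and
   1 - t <= - ln t with t = |g_k|^2 / (L q_k) give
     Psi (B_(k+1)) - Psi (B_k) <= - ln (gamma |g_k|^2 / (L delta_k)),
   where the Wolfe condition bounds <y_k, s_k> and the Armijo condition bounds
   delta_k from below. As Psi >= 0, the logarithms of gamma |g_i|^2 / (L delta_i)
   over i < k sum up to at most Psi_0. The rates follow from AM-GM: for (1) applied
   to the telescoping delta_i; for (2) to r_i = 1 / Delta_(i+1) - 1 / Delta_i, which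
   is at least delta_i / Delta_i^2 >= delta_i / (W_0 |g_i|)^2. *)
Require Import Defs.
From HB Require Import structures.
From mathcomp Require Import all_boot all_order all_algebra.
From mathcomp Require Import all_classical all_reals all_analysis.
From mathcomp Require Import ring lra.

Set Implicit Arguments.
Unset Strict Implicit.
Unset Printing Implicit Defensive.

Import Order.TTheory GRing.Theory Num.Theory.
Import numFieldNormedType.Exports.

Local Open Scope classical_set_scope.
Local Open Scope ring_scope.

(** * Positive definite matrices and the BFGS update *)

Section InnerProduct.
Context {R : realType} {d : nat}.
Implicit Types (u v w : 'cV[R]_d) (a : R).

Lemma dotE u v : dot u v = \sum_i u i 0 * v i 0.
Proof. by rewrite /dot mxE; apply: eq_bigr => i _; rewrite mxE. Qed.

Lemma dotC u v : dot u v = dot v u.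
Proof. by rewrite !dotE; apply: eq_bigr => i _; rewrite mulrC. Qed.

Lemma dotDl u v w : dot (u + v) w = dot u w + dot v w.
Proof. by rewrite /dot linearD /= mulmxDl mxE. Qed.

Lemma dotZl a u v : dot (a *: u) v = a * dot u v.
Proof. by rewrite /dot linearZ /= -scalemxAl mxE. Qed.

Lemma dotNl u v : dot (- u) v = - dot u v.
Proof. by rewrite -scaleN1r dotZl mulN1r. Qed.

Lemma dotBl u v w : dot (u - v) w = dot u w - dot v w.
Proof. by rewrite dotDl dotNl. Qed.

Lemma dotDr u v w : dot u (v + w) = dot u v + dot u w.
Proof. by rewrite dotC dotDl !(dotC u). Qed.

Lemma dotZr a u v : dot u (a *: v) = a * dot u v.
Proof. by rewrite dotC dotZl dotC. Qed.

Lemma dotNr u v : dot u (- v) = - dot u v.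
Proof. by rewrite dotC dotNl dotC. Qed.

Lemma dotBr u v w : dot u (v - w) = dot u v - dot u w.
Proof. by rewrite dotDr dotNr. Qed.

Lemma dot0l v : dot 0 v = 0.
Proof. by rewrite -(scale0r v) dotZl mul0r. Qed.

Definition dot_linear := (dotBl, dotBr, dotDl, dotDr, dotNl, dotNr, dotZl, dotZr).

Lemma dot_mulmxl (A : 'M[R]_d) u v : dot (A *m u) v = dot u (A^T *m v).
Proof. by rewrite /dot trmx_mul mulmxA. Qed.

Lemma dot_ge0 u : 0 <= dot u u.
Proof. by rewrite dotE; apply: sumr_ge0 => i _; rewrite -expr2 sqr_ge0. Qed.

Lemma dot_eq0 u : (dot u u == 0) = (u == 0).
Proof.
apply/eqP/eqP => [|->]; last by rewrite dot0l.
rewrite dotE => /eqP; rewrite psumr_eq0 => [|i _]; last by rewrite -expr2 sqr_ge0.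
move=> /allP u0; apply/matrixP => i j; rewrite mxE (ord1 j); apply/eqP.
by have := u0 i (mem_index_enum i); rewrite -expr2 sqrf_eq0.
Qed.

Lemma enorm_ge0 u : 0 <= enorm u.
Proof. exact: sqrtr_ge0. Qed.

Lemma enorm_sqr u : enorm u ^+ 2 = dot u u.
Proof. by rewrite /enorm sqr_sqrtr// dot_ge0. Qed.

Lemma enorm_eq0 u : (enorm u == 0) = (u == 0).
Proof. by rewrite -dot_eq0 -enorm_sqr sqrf_eq0. Qed.

Lemma enormZ a u : enorm (a *: u) = `|a| * enorm u.
Proof. by rewrite /enorm !dot_linear mulrA -expr2 sqrtrM ?sqr_ge0// sqrtr_sqr. Qed.

(** The squared length of [enorm v *: u - enorm u *: v] equals [2 * enorm u * enorm v * (enorm u *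
    enorm v - dot u v)]; nonzero norms can be divided out. *)
Lemma cauchy_schwarz u v : dot u v <= enorm u * enorm v.
Proof.
have [->|u0] := eqVneq u 0; first by rewrite dot0l mulr_ge0 ?enorm_ge0.
have {u0}: 0 < enorm u by rewrite lt_neqAle eq_sym enorm_eq0 u0 enorm_ge0.
have := dot_ge0 (enorm v *: u - enorm u *: v).
rewrite !dot_linear -!enorm_sqr (dotC v u).
have := enorm_ge0 v; rewrite le_eqVlt => /predU1P[v0 _ _|].
  have /eqP : enorm v = 0 by [].
  by rewrite enorm_eq0 => /eqP->; rewrite dotC dot0l mulr_ge0 ?enorm_ge0.
move=> v0 h u0.
have : 0 <= enorm u * enorm v * (enorm u * enorm v - dot u v) by nra.
by rewrite pmulr_rge0 ?mulr_gt0// subr_ge0.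
Qed.

Lemma dot_outer u v w : dot v (u *m w^T *m v) = dot u v * dot w v.
Proof.
by rewrite -mulmxA [w^T *m v]mx11_scalar mul_mx_scalar dotZr (dotC v u) mulrC.
Qed.

Lemma mxtrace_outer u v : \tr (u *m v^T) = dot v u.
Proof. by rewrite mxtrace_mulC /mxtrace big_ord1. Qed.

End InnerProduct.

(** Sylvester's identity. Multiplying the same two block matrices in either order gives a block
    triangular matrix, and each order exposes one of the two sides. *)
Lemma det_mulmx_add1C {R : comNzRingType} (m n : nat)
    (U : 'M[R]_(m, n)) (V : 'M[R]_(n, m)) :
  \det (1%:M + U *m V) = \det (1%:M + V *m U).
Proof.
have e1 : block_mx 1%:M U 0 1%:M *m block_mx 1%:M (- U) V 1%:M
    = block_mx (1%:M + U *m V) 0 V 1%:M :> 'M[R]_(m + n).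
  by rewrite mulmx_block !mul1mx !mul0mx !mulmx1 addNr !add0r.
have e2 : block_mx 1%:M (- U) V 1%:M *m block_mx 1%:M U 0 1%:M
    = block_mx 1%:M 0 V (1%:M + V *m U) :> 'M[R]_(m + n).
  by rewrite mulmx_block !mulmx1 !mul1mx !mulmx0 subrr !addr0 (addrC 1%:M).
transitivity (\det (block_mx (1%:M + U *m V) 0 V 1%:M)).
  by rewrite det_lblock det1 mulr1.
by rewrite -e1 det_mulmx mulrC -det_mulmx e2 det_lblock det1 mul1r.
Qed.

Lemma det2 {R : comNzRingType} (A : 'M[R]_2) :
  \det A = A 0 0 * A 1 1 - A 0 1 * A 1 0.
Proof.
rewrite (expand_det_row _ 0) !big_ord_recl big_ord0 /cofactor !det_mx11 !mxE /=.
rewrite expr0 expr1 mul1r addr0 mulN1r mulrN.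
by congr (A _ _ * A _ _ - A _ _ * A _ _); apply/val_inj.
Qed.

Section PositiveDefinite.
Context {R : realType}.

Lemma ln_le_sub1 (a : R) : 0 < a -> ln a <= a - 1.
Proof.
by move=> a0; rewrite -{1}[a](subrKC 1); apply: le_ln1Dx; lra.
Qed.

Lemma spd_scale (d : nat) (a : R) (B : 'M[R]_d) : 0 < a -> spd B -> spd (a *: B).
Proof.
move=> a0 [symB posB]; split; first by rewrite linearZ /= symB.
by move=> v v0; rewrite -scalemxAl dotZr mulr_gt0// posB.
Qed.

(* Induction on the dimension through the Schur complement, whose trace does not
   exceed that of the lower right block. *)
Lemma spd_det (d : nat) (B : 'M[R]_d) :
  spd B -> 0 < \det B /\ ln (\det B) <= \tr B - d%:R.
Proof.
elim: d B => [|d IH] B [symB posB].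
  by rewrite det_mx00 ln1 /mxtrace big_ord0 subrr.
pose A : 'M[R]_(1 + d) := B.
have posA (v : 'cV_(1 + d)) : v != 0 -> 0 < dot v (A *m v) by exact: posB.
pose b := ulsubmx A 0 0; pose w := dlsubmx A; pose C := drsubmx A.
have AE : A = block_mx b%:M w^T w C.
  by rewrite -[LHS]submxK -mx11_scalar trmx_dlsub /A symB.
have symC : C^T = C by rewrite /C trmx_drsub /A symB.
have quad c v : dot (col_mx c%:M v) (A *m col_mx c%:M v)
    = b * c ^+ 2 + c * dot w v *+ 2 + dot v (C *m v).
  rewrite AE mul_block_col /dot tr_col_mx mul_row_col mxE !tr_scalar_mx.
have vw := dotC v w; rewrite /dot !mxE in vw.
  rewrite !mul_scalar_mx !mul_mx_scalar mulmxDr -scalemxAr !mxE vw eqxx mulr1n.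
  by ring.
have b0 : 0 < b.
  have := posA (col_mx 1%:M 0).
  rewrite (quad 1 0) dotC dot0l dot0l expr1n mulr1 mulr0 mul0rn !addr0; apply.
  rewrite col_mx_eq0 negb_and.
  by apply/orP; left; apply/eqP => /matrixP/(_ 0 0)/eqP; rewrite !mxE oner_eq0.
pose S := C - b^-1 *: (w *m w^T).
have spdS : spd S.
  split=> [|v v0].
    by rewrite /S linearB /= linearZ /= trmx_mul trmxK symC.
  (* For fixed [v] this first coordinate minimizes the quadratic form of [A]; the minimum is the
     form of the Schur complement [S] at [v]. *)
  have := posA (col_mx (- (b^-1 * dot w v))%:M v).
  rewrite quad /S mulmxBl dotBr -scalemxAl dotZr dot_outer -expr2.
  rewrite col_mx_eq0 negb_and v0 orbT => /(_ isT).
  suff -> : b * (- (b^-1 * dot w v)) ^+ 2 + - (b^-1 * dot w v) * dot w v *+ 2 +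
    dot v (C *m v) = dot v (C *m v) - b^-1 * dot w v ^+ 2 by [].
  by field; rewrite gt_eqF.
have detA : \det A = b * \det S.
  (* One step of Gaussian elimination: [T] has determinant 1 and clears the block below [b]. *)
  pose T : 'M[R]_(1 + d) := block_mx 1%:M 0 (- (b^-1 *: w)) 1%:M.
  have <- : \det (T *m A) = \det A by rewrite det_mulmx det_lblock !det1 !mul1r.
  suff -> : T *m A = block_mx b%:M w^T 0 S by rewrite det_ublock det_scalar1.
  rewrite AE mulmx_block !mul1mx !mul0mx !addr0 mulNmx mul_mx_scalar scalerA.
  by rewrite divff ?gt_eqF// scale1r addNr mulNmx -scalemxAl addrC.
have trA : \tr A = b + \tr C.
  by rewrite AE mxtrace_block mxtrace_scalar mulr1n.
have [detS lnS] := IH S spdS.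
have trS : \tr S <= \tr C.
  rewrite /S linearB /= linearZ /= mxtrace_outer gerBl.
  by rewrite mulr_ge0 ?invr_ge0 ?(ltW b0)// dot_ge0.
rewrite -/A detA trA lnM ?posrE//; split; first exact: mulr_gt0.
have := ln_le_sub1 b0; rewrite -natr1; lra.
Qed.

Context {d : nat}.
Implicit Types (B : 'M[R]_d) (s y : 'cV[R]_d).

Lemma spd_unitmx B : spd B -> B \in unitmx.
Proof. by case/spd_det => detB _; rewrite unitmxE unitfE gt_eqF. Qed.

Lemma spd_invmx_gt0 B v : spd B -> v != 0 -> 0 < dot v (invmx B *m v).
Proof.
move=> spdB v0; have BV := mulKVmx (spd_unitmx spdB) v.
rewrite -{1}BV dot_mulmxl (proj1 spdB).
apply: (proj2 spdB); apply: contra_neq v0 => Bv0.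
by rewrite -BV Bv0 mulmx0.
Qed.

Lemma Psi_ge0 (L : R) B : 0 < L -> spd B -> 0 <= Psi L B.
Proof.
move=> L0 spdB; rewrite /Psi subr_ge0.
by have [] := spd_det (spd_scale (a:=L^-1) _ spdB); rewrite ?invr_gt0.
Qed.

Lemma Psi_scalar (L : R) : 0 < L -> Psi L (L%:M : 'M[R]_d) = 0.
Proof.
move=> L0; rewrite /Psi scale_scalar_mx mulVf ?gt_eqF// mxtrace1 det1 ln1.
by rewrite subrr subr0.
Qed.

(** Removing from [v] its [B]-orthogonal projection on [s] leaves [w], and the first two terms of
    the update contribute [dot w (B *m w)]. This vanishes only for [v] parallel to [s], where the
    [y]-term is positive because [dot y s] is. *)
Lemma spd_bfgs_update B s y : spd B -> s != 0 -> 0 < dot y s ->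
  spd (bfgs_update B s y).
Proof.
move=> spdB s0 ys0; have [symB posB] := spdB; have sBs0 := posB s s0.
have outerE : B *m s *m s^T *m B = (B *m s) *m (B *m s)^T.
  by rewrite trmx_mul symB mulmxA.
split=> [|v v0].
  by rewrite /bfgs_update outerE linearD linearB /= !linearZ /= !trmx_mul !trmxK symB.
rewrite /bfgs_update outerE mulmxDl mulmxBl -!scalemxAl dotDr dotBr !dotZr.
rewrite !dot_outer -!expr2.
pose t := dot (B *m s) v / dot s (B *m s); pose w := v - t *: s.
have wBw : dot w (B *m w)
    = dot v (B *m v) - (dot s (B *m s))^-1 * dot (B *m s) v ^+ 2.
  have sBv : dot s (B *m v) = dot (B *m s) v by rewrite dot_mulmxl symB.
  rewrite /w mulmxBr -scalemxAr !dot_linear sBv (dotC v (B *m s)) /t.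
  by field; rewrite gt_eqF.
rewrite -wBw; have [w0|w0] := eqVneq w 0; last first.
  by apply: ltr_wpDr; [rewrite mulr_ge0 ?sqr_ge0// invr_ge0 ltW|exact: posB].
have vE : v = t *: s by apply/eqP; rewrite -subr_eq0 -/w w0.
rewrite w0 dot0l add0r vE dotZr mulr_gt0 ?invr_gt0//.
rewrite lt_neqAle sqr_ge0 andbT eq_sym sqrf_eq0 mulf_neq0 ?(gt_eqF ys0)//.
by apply: contra_neq v0 => t0; rewrite vE t0 scale0r.
Qed.

Lemma mxtrace_bfgs_update B s y : spd B ->
  \tr (bfgs_update B s y)
  = \tr B - dot (B *m s) (B *m s) / dot s (B *m s) + dot y y / dot y s.
Proof.
move=> [symB _]; rewrite /bfgs_update linearD linearB /= !linearZ /=.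
have -> : B *m s *m s^T *m B = (B *m s) *m (B *m s)^T.
  by rewrite trmx_mul symB mulmxA.
rewrite !mxtrace_outer [in LHS](mulrC _^-1 (dot y y)); congr (_ + _ + _).
by rewrite scalerN /GRing.scale /= mulrC mulrN.
Qed.

(** The update is [B *m (1 + U *m V)] with [U] of width 2, so Sylvester's identity leaves a 2 by 2
    determinant. *)
Lemma det_bfgs_update B s y : spd B -> s != 0 -> 0 < dot y s ->
  \det (bfgs_update B s y) = \det B * (dot y s / dot s (B *m s)).
Proof.
move=> spdB s0 ys0; have [symB posB] := spdB; have sBs0 := posB s s0.
pose U : 'M[R]_(d, 1 + 1) := row_mx (- ((dot s (B *m s))^-1 *: s))
                             ((dot y s)^-1 *: (invmx B *m y)).
pose V : 'M[R]_(1 + 1, d) := col_mx (s^T *m B) y^T.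
have -> : bfgs_update B s y = B *m (1%:M + U *m V).
  rewrite mulmxDr mulmx1 /U /V mul_row_col mulmxDr mulNmx mulmxN.
  rewrite -!scalemxAl -!scalemxAr !mulmxA mulmxV ?spd_unitmx// mul1mx.
  by rewrite addrA.
rewrite det_mulmx det_mulmx_add1C; congr (_ * _).
pose r := dot y s; pose e := dot y (invmx B *m y) / r.
(* The upper left entry of [1 + V *m U] is 0, so its determinant is minus the product of the
   off-diagonal entries and [e] drops out. *)
have VU : V *m U = block_mx (- 1)%:M 1%:M (- (r / dot s (B *m s)))%:M e%:M.
  rewrite /V /U mul_col_row !mulmxN -!scalemxAr.
  have -> : s^T *m B *m s = (dot s (B *m s))%:M by rewrite -mulmxA [LHS]mx11_scalar.
  have -> : s^T *m B *m (invmx B *m y) = r%:M.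
    by rewrite -mulmxA mulKVmx ?spd_unitmx// [LHS]mx11_scalar -/(dot s y) dotC.
  have -> : y^T *m s = r%:M by rewrite [LHS]mx11_scalar.
  have -> : y^T *m (invmx B *m y) = (dot y (invmx B *m y))%:M.
    by rewrite [LHS]mx11_scalar.
  have opp_scalar a : - a%:M = (- a)%:M :> 'M[R]_1 by rewrite raddfN.
  rewrite !scale_scalar_mx !opp_scalar !mulVf ?gt_eqF//.
  by rewrite (mulrC _ r) (mulrC _ (dot y _)).
have i0 : 0 = lshift 1 (0 : 'I_1) :> 'I_2 by apply/val_inj.
have i1 : 1 = rshift 1 (0 : 'I_1) :> 'I_2 by apply/val_inj.
rewrite det2 ![(1%:M + _) _ _]mxE ![1%:M _ _]mxE /= VU i0 i1.
rewrite (@block_mxEul _ 1 1 1 1) (@block_mxEur _ 1 1 1 1) (@block_mxEdl _ 1 1 1 1).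
rewrite (@block_mxEdr _ 1 1 1 1) !mxE eqxx !mulr1n.
by rewrite /r; ring.
Qed.
End PositiveDefinite.

(** * Smooth convex functions *)

Section SmoothConvex.
Context {R : realType} {d : nat} (f : 'cV[R]_d -> R).
Context (df : forall x, differentiable f x).
Implicit Types (x z v : 'cV[R]_d).

Lemma derive_grad x v : 'D_v f x = dot (grad f x) v.
Proof.
rewrite deriveE// {1}[v]matrix_sum_delta linear_sum dotE.
apply: eq_bigr => i _; rewrite big_ord1 linearZ /= mulrC -deriveE//.
by rewrite mxE.
Qed.

Lemma is_derive_line x v (t : R) :
  is_derive t 1 (fun h => f (x + h *: v)) (dot (grad f (x + t *: v)) v).
Proof.
(* The difference quotient of the restriction to the line, at [t], is that of [f] at [x + t *: v] in
   direction [v]. *)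
have E : (fun h : R => h^-1 *: (((fun h => f (x + h *: v)) \o shift t) (h *: 1)
       - f (x + t *: v)))
   = (fun h : R => h^-1 *: ((f \o shift (x + t *: v)) (h *: v) - f (x + t *: v))).
  apply/funext => h /=.
  by rewrite [h *: 1]mulr1 scalerDl addrCA.
apply: DeriveDef.
  by rewrite /derivable E; exact: diff_derivable.
by rewrite -derive_grad /derive E.
Qed.

Context (cf : convex_function [set: 'cV[R]_d] f).

Lemma convex_segment x z (t : R) : 0 <= t -> t <= 1 ->
  f (x + t *: (z - x)) <= f x + t * (f z - f x).
Proof.
move=> t0 t1; have := cf (Itv01 t0 t1 : {i01 R}) (x := z) (y := x).
rewrite !inE => /(_ I I); rewrite convRE /= /unstable.onem.
have -> : conv (Itv01 t0 t1 : {i01 R}) (z : convex_lmodType 'cV[R]_d) x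
    = x + t *: (z - x).
  rewrite /conv /= /unstable.onem scalerBl scalerBr scale1r.
  by rewrite [LHS]addrC addrAC addrA.
by move/le_trans; apply; lra.
Qed.

(** By convexity the difference quotients from [x] towards [z] with step in (0, 1] are at most
    [f z - f x]; let the step tend to 0 from the right. *)
Lemma convex_gradient x z : f x + dot (grad f x) (z - x) <= f z.
Proof.
rewrite -lerBrDl -derive_grad.
have cv : (fun h : R => h^-1 *: ((f \o shift x) (h *: (z - x)) - f x)) @ 0^'+
    --> 'D_(z - x) f x.
  by apply: cvg_dnbhs_at_right; exact: (diff_derivable (df x)).
apply: (cvgr_to_le cv); near=> h.
have h0 : 0 < h by near: h; exact: nbhs_right_gt.
have h1 : h <= 1 by near: h; exact: nbhs_right_le.
rewrite [_ *: _]mulrC ler_pdivrMr//= (addrC _ x).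
by have := convex_segment x z (ltW h0) h1; lra.
Unshelve. all: by end_near. Qed.

Context (L : R) (L0 : 0 < L) (lipf : grad_lipschitz f L).

(** Along the segment, [f] minus the linear and quadratic terms is a function [h] whose derivative
    is nonpositive by Cauchy-Schwarz and the Lipschitz bound, so [h 1 <= h 0]. *)
Lemma descent_lemma x z :
  f z <= f x + dot (grad f x) (z - x) + L / 2 * enorm (z - x) ^+ 2.
Proof.
set v := z - x; pose a := dot (grad f x) v; pose n := enorm v ^+ 2.
pose h t := f (x + t *: v) - (t * a + L / 2 * n * (t * t)).
have dh (t : R) : is_derive t 1 h
    (dot (grad f (x + t *: v)) v - (a + L / 2 * n * (t + t))).
  have fl := is_derive_line x v t.
  rewrite /h; apply: is_derive_eq.
  by rewrite /GRing.scale /=; ring.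
have drv (t : R) : derivable h t 1 by have [] := dh t.
have hle : h 1 <= h 0.
  apply: (@ler0_derive1_le_cc _ h 0 1); rewrite ?in_itv/= ?lexx ?ler01//.
  - move=> t; rewrite in_itv/= => /andP[t0 _].
    rewrite derive1E derive_val.
    have := cauchy_schwarz (grad f (x + t *: v) - grad f x) v.
    have := lipf (x + t *: v) x.
    rewrite addrAC subrr add0r enormZ (gtr0_norm t0) dotBl -/a => lip cs.
    have := ler_wpM2r (enorm_ge0 v) lip; rewrite /n; lra.
  - by apply: derivable_within_continuous => t _.
move: hle; rewrite /h scale1r scale0r addr0 {1}/v subrKC -/a -/n; lra.
Qed.

(** The step [L^-1] minimizes the quadratic upper bound of the descent lemma along the negative
    gradient. *)
Lemma descent_gradient_step x :
  f (x - L^-1 *: grad f x) <= f x - enorm (grad f x) ^+ 2 / (2 * L).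
Proof.
have := descent_lemma x (x - L^-1 *: grad f x).
rewrite (addrAC x _ (- x)) subrr add0r -scaleNr dotZr enormZ exprMn real_normK ?num_real//.
rewrite -enorm_sqr => /le_trans; apply.
by rewrite le_eqVlt; apply/orP; left; apply/eqP; field; rewrite gt_eqF.
Qed.

(** With [w] the gradient difference, the tangent bound at [a] and the descent lemma at [b] are
    compared at the common point [b - L^-1 *: w]. Adding the resulting inequality [half] for both
    orders of the points cancels the values of [f]. *)
Lemma cocoercive x z :
  dot (grad f z - grad f x) (grad f z - grad f x)
  <= L * dot (grad f z - grad f x) (z - x).
Proof.
have half a b : f a + dot (grad f a) (b - a)
    + dot (grad f b - grad f a) (grad f b - grad f a) / (2 * L) <= f b.
  set w := grad f b - grad f a.
  have := convex_gradient a (b - L^-1 *: w).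
  have := descent_lemma b (b - L^-1 *: w).
  rewrite (addrAC b _ (- b)) subrr add0r (addrAC b _ (- a)).
  rewrite -scaleNr enormZ exprMn real_normK ?num_real// enorm_sqr.
  rewrite (dotDr (grad f a)) !dotZr.
  have -> : dot w w / (2 * L) = L^-1 * dot w w - L / 2 * ((- L^-1) ^+ 2 * dot w w).
    by field; rewrite gt_eqF.
  have : dot w w = dot (grad f b) w - dot (grad f a) w by rewrite {1}/w dotBl.
  by move=> ->; lra.
have := half x z; have := half z x.
rewrite -[x - z]opprB -[grad f x - grad f z]opprB !dotNl !dotNr opprK.
set y := grad f z - grad f x => h1 h2.
have : dot y y / (2 * L) + dot y y / (2 * L) <= dot y (z - x).
  by rewrite {5}/y dotBl; lra.
have -> : dot y y / (2 * L) + dot y y / (2 * L) = dot y y / L.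
  by field; rewrite gt_eqF.
by rewrite ler_pdivrMr// mulrC.
Qed.

End SmoothConvex.

(** * The convergence rate *)

(* The AM-GM inequality for the [r i], in logarithmic form. *)
Lemma sum_ge_expR_sum_ln {R : realType} (n : nat) (r : nat -> R) (c P : R) :
  (0 < n)%N -> 0 < c -> (forall i, (i < n)%N -> 0 < r i) ->
  \sum_(i < n) ln (c / r i) <= P ->
  c * n%:R * expR (- P / n%:R) <= \sum_(i < n) r i.
Proof.
move=> n0 c0 r0 sumP; have nR : 0 < n%:R :> R by rewrite ltr0n.
set S := \sum_(i < n) r i.
have S0 : 0 < S.
  rewrite /S; case: n n0 r0 {sumP nR S} => // n _ r0.
  rewrite big_ord_recl ltr_pwDl ?r0// sumr_ge0// => i _.
  exact/ltW/r0.
pose m := S / n%:R; have m0 : 0 < m by rewrite divr_gt0.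
(* Here [m] is the mean of the [r i], so the corrections [r i / m - 1] sum to zero. *)
have step (i : 'I_n) : ln (c / m) <= ln (c / r i) + (r i / m - 1).
  have ri0 := r0 i (ltn_ord i).
  have -> : c / m = c / r i * (r i / m) by field; rewrite !gt_eqF.
  by rewrite lnM ?posrE ?divr_gt0// lerD2l ln_le_sub1// divr_gt0.
have : n%:R * ln (c / m) <= P.
  rewrite mulr_natl -[n in _ *+ n]card_ord -sumr_const.
  apply: le_trans (ler_sum _ (fun i _ => step i)) _.
  rewrite big_split /= sumrB -mulr_suml sumr_const card_ord -/S /m.
  have -> : S / (S / n%:R) = n%:R by field; rewrite !gt_eqF.
  by rewrite subrr addr0.
rewrite (mulrC _ (ln _)) -ler_pdivlMr// => lncm.
have : c / m <= expR (P / n%:R) by rewrite -ler_ln ?posrE ?divr_gt0 ?expR_gt0// expRK.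
rewrite ler_pdivrMr// => cm.
rewrite mulNr expRN mulrAC -ler_pdivlMr// -/m ler_pdivrMr ?expR_gt0//.
by rewrite mulrC.
Qed.

Lemma PsiE {R : realType} {d : nat} (L : R) (B : 'M[R]_d) :
  Psi L B = L^-1 * \tr B - d%:R - ln (L^-1 ^+ d * \det B).
Proof. by rewrite /Psi mxtraceZ detZ. Qed.

(** * Change of the potential over one BFGS step *)

Section BFGSStep.
Context {R : realType} {d : nat} (f : 'cV[R]_d -> R) (L : R).
Context (df : forall x, differentiable f x)
  (cf : convex_function [set: 'cV[R]_d] f)
  (L0 : 0 < L) (lipf : grad_lipschitz f L).

(** At a minimizer a gradient step cannot decrease [f], which forces a zero gradient; the converse
    is the tangent bound. *)
Lemma argmin_gradP x : argmin f x <-> grad f x = 0.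
Proof.
split=> [fmin|g0 z].
  have := le_trans (fmin _) (descent_gradient_step df L0 lipf x).
  rewrite lerDl oppr_ge0 pmulr_lle0 ?invr_gt0 ?mulr_gt0// => h.
  apply/eqP; rewrite -enorm_eq0 -sqrf_eq0 eq_le h sqr_ge0//.
by have := convex_gradient df cf x z; rewrite g0 dot0l addr0.
Qed.

Lemma bfgs_step_potential (c1 c2 a : R) x x' B B' :
  0 < c1 -> c2 < 1 -> spd B -> grad f x != 0 -> bfgs_step f c1 c2 x B a x' B' ->
  [/\ spd B', f x' < f x
    & ln (c1 * (1 - c2) * enorm (grad f x) ^+ 2 / (L * (f x - f x')))
      <= Psi L B - Psi L B'].
Proof.
move=> c10 c21 spdB gn0 [a0 arm wol xE BE]; rewrite /armijo /wolfe -xE in arm wol.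
set g := grad f x in gn0 arm wol BE xE *; set g' := grad f x' in wol BE.
set p := - (invmx B *m g) in arm wol xE.
pose q := dot g (invmx B *m g); pose G := dot g g.
have q0 : 0 < q by exact: spd_invmx_gt0.
have gp : dot g p = - q by rewrite /p dotNr.
set s := x' - x in BE; set y := g' - g in BE.
have sE : s = a *: p by rewrite /s xE addrAC subrr add0r.
(* Since [p] solves [B *m p = - g], every [B]-dependent quantity of the update reduces to [a], [q]
   and [G]. *)
have Bs : B *m s = - (a *: g).
  by rewrite sE -scalemxAr /p mulmxN mulKVmx ?spd_unitmx// scalerN.
have sBs : dot s (B *m s) = a ^+ 2 * q.
  by rewrite Bs sE dotNr dotZl dotZr dotC gp; ring.
have BsBs : dot (B *m s) (B *m s) = a ^+ 2 * G.
  by rewrite Bs dotNl dotNr dotZl dotZr -/G; ring.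
have s0 : s != 0.
  apply/eqP => s0; have := sBs; rewrite s0 dot0l => /esym/eqP.
  by rewrite mulf_eq0 sqrf_eq0 !gt_eqF.
have ysE : dot y s = a * (dot g' p - dot g p) by rewrite sE dotZr /y dotBl.
have ys : a * ((1 - c2) * q) <= dot y s.
  by rewrite ysE ler_pM2l//; move: wol; rewrite gp; lra.
have cq0 : 0 < (1 - c2) * q by rewrite mulr_gt0// subr_gt0.
have ys0 : 0 < dot y s by apply: lt_le_trans ys; rewrite mulr_gt0.
have G0 : 0 < G by rewrite lt_neqAle eq_sym dot_eq0 gn0 dot_ge0.
have dlt : c1 * a * q <= f x - f x' by move: arm; rewrite gp; lra.
have d0 : 0 < f x - f x' by apply: lt_le_trans dlt; rewrite !mulr_gt0.
have spdB' : spd B' by rewrite BE; exact: spd_bfgs_update.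
split => //; first by rewrite -subr_gt0.
have coco : dot y y / (L * dot y s) <= 1.
  rewrite ler_pdivrMr ?mulr_gt0// mul1r.
  exact: (cocoercive df cf L0 lipf).
(* In the scaled potential, [t] is what the [s]-term subtracts from the trace and [r] is the factor
   gained by the determinant. *)
pose t := G / (q * L); have t0 : 0 < t by rewrite divr_gt0// mulr_gt0.
pose r := dot y s / (a ^+ 2 * q).
have r0 : 0 < r by rewrite divr_gt0// mulr_gt0 ?exprn_gt0.
pose D : R := L^-1 ^+ d * \det B.
have D0 : 0 < D.
  by rewrite mulr_gt0 ?exprn_gt0 ?invr_gt0//; have [] := spd_det spdB.
have detE : L^-1 ^+ d * \det B' = D * r.
  by rewrite BE det_bfgs_update// sBs /D /r; ring.
have trE : L^-1 * \tr B' = L^-1 * \tr B - t + dot y y / (L * dot y s).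
  rewrite BE mxtrace_bfgs_update// sBs BsBs /t.
  by field; rewrite !gt_eqF.
have lnt : ln t <= t - 1 by exact: ln_le_sub1.
(* Wolfe gives [r >= (1 - c2) / a], and Armijo bounds [1 / a] below by [c1 * q / (f x - f x')]. *)
have key : ln (c1 * (1 - c2) * enorm g ^+ 2 / (L * (f x - f x')))
    <= ln t + ln r.
  rewrite -(lnM (x := t) (y := r)) ?posrE// enorm_sqr -/G.
  have c2' : 0 < 1 - c2 by rewrite subr_gt0.
  rewrite ler_ln ?posrE; last 2 first.
  - by rewrite divr_gt0 ?mulr_gt0.
  - exact: mulr_gt0.
  apply: (@le_trans _ _ (t * ((1 - c2) / a))); last first.
    rewrite ler_pM2l// ler_pdivlMr ?mulr_gt0 ?exprn_gt0//.
    apply: le_trans ys; rewrite le_eqVlt; apply/orP; left; apply/eqP.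
    by field; rewrite gt_eqF.
  have -> : t * ((1 - c2) / a) = c1 * (1 - c2) * G / (L * (c1 * a * q)).
    by rewrite /t; field; rewrite !gt_eqF.
  rewrite ler_pM2l ?mulr_gt0// lef_pV2 ?posrE ?mulr_gt0//.
  by rewrite ler_pM2l.
have PsiB : Psi L B = L^-1 * \tr B - d%:R - ln D by exact: PsiE.
have PsiB' : Psi L B' = L^-1 * \tr B' - d%:R - ln (D * r) by rewrite PsiE detE.
have lnDr : ln (D * r) = ln D + ln r by rewrite lnM ?posrE.
(* The decrease of [Psi] is [t - dot y y / (L * dot y s) + ln r], at least [t - 1 + ln r] by [coco],
   hence at least [ln t + ln r]. *)
by rewrite PsiB PsiB' trE lnDr; lra.
Qed.

End BFGSStep.

(** * The optimality gap and its bounds through [W0] and [R0] *)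

Section OptimalityGap.
Context {R : realType} {d : nat} (f : 'cV[R]_d -> R).
Context (f_lb : has_lbound (range f)).

Lemma fstar_le x : fstar f <= f x.
Proof. by apply: ge_inf => //; exists x. Qed.

Lemma fstar_argmin z : argmin f z -> fstar f = f z.
Proof.
move=> fz; apply/eqP; rewrite eq_le fstar_le /=.
by apply: lb_le_inf => [|_ [x _ <-]]; [exists (f z), z|exact: fz].
Qed.

Lemma fstar_lt x : ~ argmin f x -> fstar f < f x.
Proof.
move=> xNmin; rewrite ltNge; apply/negP => fx.
by apply: xNmin => z; apply: le_trans fx (fstar_le z).
Qed.

Lemma gap_le_W0 x0 x : (W0 f x0 < +oo)%E -> ~ argmin f x -> f x <= f x0 ->
  0 < enorm (grad f x) ->
  0 < fine (W0 f x0) /\ f x - fstar f <= fine (W0 f x0) * enorm (grad f x).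
Proof.
move=> Wfin xNmin fx gx.
have ltW : (((f x - fstar f) / enorm (grad f x))%:E <= W0 f x0)%E.
  by apply: ereal_sup_ubound; exists x.
(* The real quotient at [x] keeps the supremum above -oo, so [fine] returns its true value. *)
have Wnum : W0 f x0 \is a fin_num.
  by rewrite fin_numE (lt_eqF Wfin) andbT gt_eqF// (lt_le_trans _ ltW)// ltNyr.
move: ltW; rewrite -(fineK Wnum) lee_fin ler_pdivrMr// fineK// => gapW; split=> //.
by rewrite -(pmulr_lgt0 _ gx); apply: lt_le_trans gapW; rewrite subr_gt0 fstar_lt.
Qed.

(** For each minimizer [z], convexity and Cauchy-Schwarz bound the gap at [x] by
    [enorm (grad f x) * enorm (x - z)]; take the infimum over [z]. *)
Lemma W0_le_R0 x0 : (forall x, differentiable f x) ->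
  convex_function [set: 'cV[R]_d] f ->
  (forall x, ~ argmin f x -> grad f x != 0) -> (W0 f x0 <= R0 f x0)%E.
Proof.
move=> df cf gradN0; apply: ge_ereal_sup => _ [x [xNmin fx] <-].
apply: (@le_trans _ _ (dist x (argmin f))); last first.
  by apply: ereal_sup_ubound; exists x.
apply: le_ereal_inf_tmp => _ [z zmin <-].
have gx : 0 < enorm (grad f x).
  by rewrite lt_neqAle eq_sym enorm_eq0 gradN0// enorm_ge0.
rewrite lee_fin ler_pdivrMr// mulrC (fstar_argmin zmin).
apply: le_trans (cauchy_schwarz _ _).
by have := convex_gradient df cf x z; rewrite -[z - x]opprB dotNr; lra.
Qed.

End OptimalityGap.

Theorem theorem3p1 (R : realType) (d : nat) (f : 'cV[R]_d -> R) (L c1 c2 : R)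
    (x0 : 'cV[R]_d) (B0 : 'M[R]_d)
    (x : nat -> 'cV[R]_d) (B : nat -> 'M[R]_d) (alpha : nat -> R)
    (hC1 : continuously_differentiable f)
    (hconv : convex_function [set: 'cV[R]_d] f)
    (hbelow : has_lbound (range f))
    (hL : 0 < L) (hLip : grad_lipschitz f L)
    (hB0 : spd B0) (hc1 : 0 < c1) (hc12 : c1 < c2) (hc2 : c2 < 1)
    (hrun : bfgs_run f c1 c2 x0 B0 x B alpha)
    (k : nat) (hk : (1 <= k)%N) :
  let Delta (i : nat) := f (x i) - fstar f in
  let g (i : nat) := grad f (x i) in
  let gamma := c1 * (1 - c2) in
  let Psi0 := Psi L B0 in
  let W := fine (W0 f x0) in
  (forall j, (j <= k)%N -> reached f x j -> argmin f (x j) ->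
    terminates_at f x j) /\
  (~ (exists j, [/\ (j <= k)%N, reached f x j & argmin f (x j)]) ->
    [/\ \big[Num.min/enorm (g 0%N) ^+ 2]_(i < k) enorm (g i) ^+ 2
          <= L * Delta 0%N / (gamma * k%:R) * expR (Psi0 / k%:R),
        argmin f !=set0 -> (W0 f x0 < +oo)%E ->
          Delta k <= ((Delta 0%N)^-1
                      + gamma * k%:R / (L * W ^+ 2) * expR (- Psi0 / k%:R))^-1
      & argmin f !=set0 -> (W0 f x0 < +oo)%E -> B0 = L%:M ->
          [/\ enorm (g k) ^+ 2 / (2 * L) <= Delta k,
              Delta k <= L * W ^+ 2 / (gamma * k%:R)
            & ((L * W ^+ 2 / (gamma * k%:R))%:E
               <= (L / (gamma * k%:R))%:E * R0 f x0 ^+ 2)%E]]).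
Proof.
move=> Delta g gamma Psi0 W.
have [df _] := hC1; have [x00 B00 step] := hrun.
have gradP := argmin_gradP df hconv hL hLip.
have gamma0 : 0 < gamma by rewrite mulr_gt0 ?subr_gt0.
have kR : 0 < k%:R :> R by rewrite ltr0n.
split=> [j _ reachj /gradP gj0|noopt].
  by split=> //; apply/eqP; rewrite enorm_eq0 gj0.
(* Strong induction, because [noopt] only excludes optimal iterates that are reached, and being
   reached means that all earlier gradients are nonzero. *)
have gN0 i : (i <= k)%N -> g i != 0.
  elim/ltn_ind: i => i IH ik; apply/eqP => /gradP xi_min; apply: noopt.
  exists i; split=> // j ji; rewrite enorm_eq0 IH//.
  exact: leq_trans (ltnW ji) ik.
have gP i : (i <= k)%N -> 0 < enorm (g i).
  by move=> ik; rewrite lt_neqAle eq_sym enorm_eq0 gN0// enorm_ge0.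
have stepk i : (i < k)%N ->
    bfgs_step f c1 c2 (x i) (B i) (alpha i) (x i.+1) (B i.+1).
  move=> ik; apply: step => j ji; rewrite enorm_eq0 gN0//.
  by rewrite (leq_trans _ (ltnW ik)).
pose delta i := f (x i) - f (x i.+1).
(* The potential inequality telescopes, while monotone descent keeps the iterates in the sublevel
   set over which [W0] is taken. *)
have inv n : (n <= k)%N -> [/\ spd (B n), f (x n) <= f x0 &
    \sum_(i < n) ln (gamma * enorm (g i) ^+ 2 / (L * delta i)) + Psi L (B n) <= Psi0].
  elim: n => [_|n IH nk]; first by rewrite B00 x00 big_ord0 add0r.
  have [spdB fn sumn] := IH (ltnW nk).
  have [spdB' flt psi] := bfgs_step_potential df hconv hL hLip hc1 hc2 spdB
    (gN0 n (ltnW nk)) (stepk n nk).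
  split=> //; first exact: le_trans (ltW flt) fn.
  rewrite big_ord_recr /= -/g.
  by move: psi; rewrite -/gamma -/(delta n) -/(g n); lra.
clearbody gamma.
have delta0 i : (i < k)%N -> 0 < delta i.
  move=> ik; have [spdB _ _] := inv i (ltnW ik).
  have [_ flt _] := bfgs_step_potential df hconv hL hLip hc1 hc2 spdB
    (gN0 i (ltnW ik)) (stepk i ik).
  by rewrite subr_gt0.
have sum_ln : \sum_(i < k) ln (gamma * enorm (g i) ^+ 2 / (L * delta i)) <= Psi0.
  have [spdB _] := inv k (leqnn k); apply: le_trans.
  by rewrite lerDl Psi_ge0.
have DeltaP i : (i <= k)%N -> 0 < Delta i.
  move=> ik; rewrite subr_gt0; apply: fstar_lt => // /gradP gi0.
  by have := gN0 i ik; rewrite /g gi0 eqxx.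
(* Bound (2) in reciprocal form, which serves (3) as well. *)
have part2 : (W0 f x0 < +oo)%E -> 0 < W /\
    (Delta 0%N)^-1 + gamma * k%:R / (L * W ^+ 2) * expR (- Psi0 / k%:R)
      <= (Delta k)^-1.
  move=> Wfin.
  have gap i : (i <= k)%N -> 0 < W /\ Delta i <= W * enorm (g i).
    move=> ik; have [_ fi _] := inv i ik.
    apply: gap_le_W0 => //; last exact: gP.
    by move=> /gradP gi0; have := gN0 i ik; rewrite /g gi0 eqxx.
  have [WP _] := gap 0%N (leq0n k); split=> //.
  (* With this [c], comparing [c / r i] with the logarithm's argument in [sum_ln] amounts to [Delta
     i * Delta i.+1 <= (W * enorm (g i)) ^+ 2], which follows from descent and the gap bound. *)
  pose c := gamma / (L * W ^+ 2).
  have c0 : 0 < c by rewrite divr_gt0 ?mulr_gt0 ?exprn_gt0.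
  pose r i := (Delta i.+1)^-1 - (Delta i)^-1.
  have rE i : (i < k)%N -> r i = delta i / (Delta i * Delta i.+1).
    move=> ik; have D0 := DeltaP i (ltnW ik); have D1 := DeltaP i.+1 ik.
    have -> : delta i = Delta i - Delta i.+1 by rewrite /delta /Delta; ring.
    by rewrite /r; field; rewrite !gt_eqF.
  have r0 i : (i < k)%N -> 0 < r i.
    by move=> ik; rewrite rE// divr_gt0 ?mulr_gt0 ?delta0 ?DeltaP// ltnW.
  have lnr (i : 'I_k) :
      ln (c / r i) <= ln (gamma * enorm (g i) ^+ 2 / (L * delta i)).
    have ik := ltn_ord i; have D0 := DeltaP i (ltnW ik).
    have D1 := DeltaP i.+1 ik; have del0 := delta0 i ik.
    have [_ gapi] := gap i (ltnW ik); have g0 := gP i (ltnW ik).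
    rewrite ler_ln ?posrE ?divr_gt0 ?mulr_gt0 ?exprn_gt0 ?r0//.
    have -> : c / r i = gamma * (Delta i * Delta i.+1 / W ^+ 2) / (L * delta i).
      by rewrite rE// /c; field; rewrite !gt_eqF.
    rewrite ler_pM2r ?invr_gt0 ?mulr_gt0// ler_pM2l//.
    rewrite ler_pdivrMr ?exprn_gt0// -exprMn (mulrC _ W).
    apply: (@le_trans _ _ (Delta i ^+ 2)).
      rewrite expr2 ler_pM2l//.
      by move: del0; rewrite /delta /Delta; lra.
    by rewrite ler_sqr ?nnegrE ?(ltW D0)// mulr_ge0// ltW.
  have := sum_ge_expR_sum_ln hk c0 r0
    (le_trans (ler_sum _ (fun i _ => lnr i)) sum_ln).
  rewrite -(big_mkord xpredT r) telescope_sumr// /c mulrAC; lra.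
have part3 : B0 = L%:M -> Psi0 = 0 by move=> B0E; rewrite /Psi0 B0E Psi_scalar.
split=> [|_ Wfin|_ Wfin /part3 Psi00].
(* The default value of the minimum is its term at 0, which belongs to the range because [k] is
   positive. *)
- pose M := \big[Num.min/enorm (g 0%N) ^+ 2]_(i < k) enorm (g i) ^+ 2.
  rewrite -/M.
  have D0 := DeltaP 0%N (leq0n k).
  have [M0|M0] := leP M 0.
    apply: le_trans M0 _; rewrite mulr_ge0 ?expR_ge0//.
    by rewrite divr_ge0 ?mulr_ge0// ltW.
  (* Each squared gradient norm is at least [M], so AM-GM applies to the decreases [delta i] with
     this constant, positive in the remaining case. *)
  pose c := gamma * M / L.
  have c0 : 0 < c by rewrite divr_gt0 ?mulr_gt0.
  have lnd (i : 'I_k) :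
      ln (c / delta i) <= ln (gamma * enorm (g i) ^+ 2 / (L * delta i)).
    have ik := ltn_ord i; have del0 := delta0 i ik.
    have g0 := gP i (ltnW ik).
    rewrite ler_ln ?posrE ?divr_gt0 ?mulr_gt0 ?exprn_gt0//.
    have -> : c / delta i = gamma * M / (L * delta i).
      by rewrite /c; field; rewrite !gt_eqF.
    rewrite ler_pM2r ?invr_gt0 ?mulr_gt0// ler_pM2l//.
    exact: (@bigmin_le _ _ _ _ i (fun i : 'I_k => enorm (g i) ^+ 2)).
  have := sum_ge_expR_sum_ln hk c0 delta0
    (le_trans (ler_sum _ (fun i _ => lnd i)) sum_ln).
  have -> : \sum_(i < k) delta i = Delta 0%N - Delta k.
    rewrite -(big_mkord xpredT delta) -[LHS]opprK -sumrN.
    rewrite (eq_bigr (fun i => f (x i.+1) - f (x i))) => [|i _]; last exact: opprB.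
    by rewrite telescope_sumr// /Delta; ring.
  have Dk := DeltaP k (leqnn k) => h.
  have {h} h : c * k%:R * expR (- Psi0 / k%:R) <= Delta 0%N by lra.
  rewrite mulNr expRN ler_pdivrMr ?expR_gt0// in h.
  rewrite mulrAC ler_pdivlMr ?mulr_gt0//.
  have -> : M * (gamma * k%:R) = L * (c * k%:R) by rewrite /c; field; rewrite gt_eqF.
  by rewrite -[leRHS]mulrA ler_pM2l.
- have [WP h] := part2 Wfin.
  rewrite -[leLHS]invrK lef_pV2 ?posrE//.
    by rewrite invr_gt0 DeltaP.
  rewrite addr_gt0 ?invr_gt0 ?DeltaP//.
  by rewrite mulr_gt0 ?expR_gt0// divr_gt0 ?mulr_gt0 ?exprn_gt0.
- have [WP h] := part2 Wfin.
  split.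
  (* A gradient step from [x k] cannot fall below [fstar f]. *)
  + have := le_trans (fstar_le hbelow _) (descent_gradient_step df hL hLip (x k)).
    by rewrite -/(g k) /Delta; lra.
  + rewrite -[leLHS]invrK -[leRHS]invrK lef_pV2 ?posrE ?invr_gt0 ?DeltaP//; last first.
      by rewrite divr_gt0 ?mulr_gt0 ?exprn_gt0.
    (* With [Psi0 = 0] the exponential is 1, and the positive term [(Delta 0)^-1] is dropped. *)
    apply: le_trans h; rewrite invf_div Psi00 oppr0 mul0r expR0 mulr1 lerDr.
    by rewrite invr_ge0 ltW ?DeltaP.
  + have WR : (W0 f x0 <= R0 f x0)%E.
      apply: W0_le_R0 => // z zNmin; apply/eqP => /gradP; exact: zNmin.
    (* The value -oo is excluded because [fine] sends it to 0 whereas [W] is positive. *)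
    have WE : W0 f x0 = W%:E.
      rewrite /W fineK// fin_numElt Wfin andbT ltNye.
      by apply: contraTneq WP => WE; rewrite /W WE ltxx.
    rewrite mulrAC EFinM lee_pmul2l//; last first.
      by rewrite lte_fin divr_gt0 ?mulr_gt0.
    have W0' : (0 <= W0 f x0)%E by rewrite WE lee_fin ltW.
    by rewrite EFin_expe -WE lee_sqr// (le_trans W0' WR).
Qed.
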